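(* Let $\mathcal{V}$ be a braided monoidal closed category that has an initial object. Let $A$, $B$ be monoids in $\mathcal{V}$, let $M$ be a (right) $A$-module and $N$ a (right) $B$-module. If the universal measuring comodule $Q(M,N)$ exists, then the universal measuring comonoid $P(A,B)$ exists. Furthermore, given a choice of $Q(M,N)$, its underlying comonoid satisfies the universal property of $P(A,B)$.
   Context: Let $(\mathcal{V},\otimes,I)$ be braided monoidal closed, with $[X,-]$ right adjoint to $-\otimes X$. $\mathsf{Mon}(\mathcal{V})$, $\mathsf{Comon}(\mathcal{V})$ are the categories of monoids and comonoids. $\mathsf{Mod}(\mathcal{V})$ (global category of modules) has objects $M_A$, with $A$ a monoid and $M$ a right $A$-module with action $\mu$; a morphism $M_A\to N_B$ is a pair $(p,f)$ with $f\colon A\to B$ a monoid morphism and $p\colon M\to N$ in $\mathcal{V}$ such that $p\circ\mu=\mu\circ(p\otimes f)$. $\mathsf{Comod}(\mathcal{V})$ (global category of comodules) has objects $X_C$, with $C$ a comonoid and $X$ a right $C$-comodule with coaction $\chi\colon X\to X\otimes C$; a morphism $X_C\to Y_D$ is a pair $(k,g)$ with $g\colon C\to D$ a comonoid morphism and $k\colon X\to Y$ such that $\chi\circ k=(k\otimes g)\circ\chi$. The underlying comonoid of $X_C$ is $C$. For a comonoid $C$ and a monoid $B$, $[C,B]$ is a monoid under convolution: its multiplication is the transpose of $[C,B]\otimes[C,B]\otimes C\to[C,B]\otimes[C,B]\otimes C\otimes C\cong[C,B]\otimes C\otimes[C,B]\otimes C\to B\otimes B\to B$ (comultiplication, braiding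 $c_{[C,B],C}$, evaluations, multiplication). For a comodule $X_C$ and a module $N_B$, $[X,N]$ is a $[C,B]$-module with action the transpose of $[X,N]\otimes[C,B]\otimes X\to[X,N]\otimes[C,B]\otimes X\otimes C\cong[X,N]\otimes X\otimes[C,B]\otimes C\to N\otimes B\to N$ (coaction, braiding $c_{[C,B],X}$, evaluations, action). The universal measuring comonoid $P(A,B)$ is a comonoid representing $C\mapsto\mathsf{Mon}(\mathcal{V})(A,[C,B])$, i.e. with an isomorphism $\mathsf{Comon}(\mathcal{V})(C,P(A,B))\cong\mathsf{Mon}(\mathcal{V})(A,[C,B])$ natural in $C$. The universal measuring comodule $Q(M,N)$ is an object of $\mathsf{Comod}(\mathcal{V})$ with an isomorphism $\mathsf{Comod}(\mathcal{V})(X,Q(M,N))\cong\mathsf{Mod}(\mathcal{V})(M,[X,N])$ natural in $X\in\mathsf{Comod}(\mathcal{V})$. *)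

(* Defs.v *)
From Stdlib Require Import ProofIrrelevance.
From mathcomp Require Import ssreflect ssrfun ssrbool.

Set Implicit Arguments.
Unset Strict Implicit.
Unset Printing Implicit Defensive.

Declare Scope cat_scope.
Delimit Scope cat_scope with cat.
Local Open Scope cat_scope.

Reserved Notation "X ~> Y" (at level 70, no associativity).
Reserved Notation "g ∘ f" (at level 50, left associativity).
Reserved Notation "X ⊗ Y" (at level 40, left associativity).
Reserved Notation "f ⊠ g" (at level 40, left associativity).

Record category := Category {
  ob :> Type;
  hom : ob -> ob -> Type where "X ~> Y" := (hom X Y);
  idm : forall X, X ~> X;
  comp : forall X Y Z, Y ~> Z -> X ~> Y -> X ~> Z
    where "g ∘ f" := (comp g f);
  compA : forall X Y Z W (h : Z ~> W) (g : Y ~> Z) (f : X ~> Y),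
    h ∘ (g ∘ f) = h ∘ g ∘ f;
  comp1m : forall X Y (f : X ~> Y), idm Y ∘ f = f;
  compm1 : forall X Y (f : X ~> Y), f ∘ idm X = f
}.

Arguments hom {_} _ _.
Arguments idm {_} _.
Arguments comp {_ _ _ _} _ _.

Notation "X ~> Y" := (hom X Y) : cat_scope.
Notation "g ∘ f" := (comp g f) : cat_scope.

Record contrafunctor (C D : category) := Contrafunctor {
  fob :> C -> D;
  fmap : forall X Y : C, (X ~> Y) -> (fob Y ~> fob X);
  fmap_id : forall X, fmap (idm X) = idm (fob X);
  fmap_comp : forall X Y Z (g : Y ~> Z) (f : X ~> Y),
    fmap (g ∘ f) = fmap f ∘ fmap g
}.

(* [P] represents the presheaf [X |-> D(d, F X)] on [C], naturally in [X]. *)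
Definition represents (C D : category) (F : contrafunctor C D) (d : D) (P : C)
    : Prop :=
  exists phi : forall X : C, (X ~> P) -> (d ~> F X),
    (forall X, bijective (phi X)) /\
    (forall (X Y : C) (g : X ~> Y) (h : Y ~> P),
       phi X (h ∘ g) = fmap F g ∘ phi Y h).

Definition is_initial (C : category) (O : C) : Prop :=
  forall X : C, exists f : O ~> X, forall g : O ~> X, g = f.

Definition has_initial (C : category) : Prop := exists O : C, is_initial O.

Record monoidal_category := MonoidalCategory {
  mc_cat :> category;
  tensor : mc_cat -> mc_cat -> mc_cat where "X ⊗ Y" := (tensor X Y);
  tensorm : forall X X' Y Y' : mc_cat, X ~> X' -> Y ~> Y' -> X ⊗ Y ~> X' ⊗ Y'
    where "f ⊠ g" := (tensorm f g);
  munit : mc_cat;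
  assoc : forall X Y Z, X ⊗ Y ⊗ Z ~> X ⊗ (Y ⊗ Z);
  associ : forall X Y Z, X ⊗ (Y ⊗ Z) ~> X ⊗ Y ⊗ Z;
  lunit : forall X, munit ⊗ X ~> X;
  luniti : forall X, X ~> munit ⊗ X;
  runit : forall X, X ⊗ munit ~> X;
  runiti : forall X, X ~> X ⊗ munit;
  tensor_id : forall X Y : mc_cat, idm X ⊠ idm Y = idm (X ⊗ Y);
  tensor_comp : forall X X' X'' Y Y' Y'' (f' : X' ~> X'') (f : X ~> X')
      (g' : Y' ~> Y'') (g : Y ~> Y'),
    (f' ∘ f) ⊠ (g' ∘ g) = (f' ⊠ g') ∘ (f ⊠ g);
  assocK : forall X Y Z, associ X Y Z ∘ assoc X Y Z = idm _;
  assocVK : forall X Y Z, assoc X Y Z ∘ associ X Y Z = idm _;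
  lunitK : forall X, luniti X ∘ lunit X = idm _;
  lunitVK : forall X, lunit X ∘ luniti X = idm _;
  runitK : forall X, runiti X ∘ runit X = idm _;
  runitVK : forall X, runit X ∘ runiti X = idm _;
  assoc_nat : forall X X' Y Y' Z Z' (f : X ~> X') (g : Y ~> Y') (h : Z ~> Z'),
    assoc X' Y' Z' ∘ ((f ⊠ g) ⊠ h) = (f ⊠ (g ⊠ h)) ∘ assoc X Y Z;
  lunit_nat : forall X Y (f : X ~> Y), lunit Y ∘ (idm _ ⊠ f) = f ∘ lunit X;
  runit_nat : forall X Y (f : X ~> Y), runit Y ∘ (f ⊠ idm _) = f ∘ runit X;
  triangle : forall X Y,
    (idm X ⊠ lunit Y) ∘ assoc X munit Y = runit X ⊠ idm Y;
  pentagon : forall X Y Z W,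
    assoc X Y (Z ⊗ W) ∘ assoc (X ⊗ Y) Z W
    = (idm X ⊠ assoc Y Z W) ∘ assoc X (Y ⊗ Z) W ∘ (assoc X Y Z ⊠ idm W)
}.

Arguments tensor {_} _ _.
Arguments tensorm {_ _ _ _ _} _ _.
Arguments munit {_}.
Arguments assoc {_} _ _ _.
Arguments associ {_} _ _ _.
Arguments lunit {_} _.
Arguments luniti {_} _.
Arguments runit {_} _.
Arguments runiti {_} _.

Notation "X ⊗ Y" := (tensor X Y) : cat_scope.
Notation "f ⊠ g" := (tensorm f g) : cat_scope.

Record braided_category := BraidedCategory {
  bc_mon :> monoidal_category;
  braid : forall X Y : bc_mon, X ⊗ Y ~> Y ⊗ X;
  braidi : forall X Y : bc_mon, Y ⊗ X ~> X ⊗ Y;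
  braidK : forall X Y, braidi X Y ∘ braid X Y = idm _;
  braidVK : forall X Y, braid X Y ∘ braidi X Y = idm _;
  braid_nat : forall X X' Y Y' (f : X ~> X') (g : Y ~> Y'),
    braid X' Y' ∘ (f ⊠ g) = (g ⊠ f) ∘ braid X Y;
  hexagon1 : forall X Y Z,
    assoc Y Z X ∘ braid X (Y ⊗ Z) ∘ assoc X Y Z
    = (idm Y ⊠ braid X Z) ∘ assoc Y X Z ∘ (braid X Y ⊠ idm Z);
  hexagon2 : forall X Y Z,
    associ Z X Y ∘ braid (X ⊗ Y) Z ∘ associ X Y Z
    = (braid X Z ⊠ idm Y) ∘ associ X Z Y ∘ (idm X ⊠ braid Y Z)
}.

Arguments braid {_} _ _.
Arguments braidi {_} _ _.

(* [ihom X -] is right adjoint to [- ⊗ X], with counit [ev X]. *)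
Record bmc_category := BmcCategory {
  bmc_br :> braided_category;
  ihom : bmc_br -> bmc_br -> bmc_br;
  ev : forall X Y : bmc_br, ihom X Y ⊗ X ~> Y;
  curry : forall X Y Z : bmc_br, (Z ⊗ X ~> Y) -> (Z ~> ihom X Y);
  curryK : forall X Y Z (f : Z ⊗ X ~> Y), ev X Y ∘ (curry f ⊠ idm X) = f;
  curry_uniq : forall X Y Z (g : Z ~> ihom X Y),
    curry (ev X Y ∘ (g ⊠ idm X)) = g
}.

Arguments ihom {_} _ _.
Arguments ev {_} _ _.
Arguments curry {_ _ _ _} _.

Section Structures.
Variable V : monoidal_category.
Local Notation I := (@munit V).

Record monoid := Monoid {
  mon_ob :> V;
  mul : mon_ob ⊗ mon_ob ~> mon_ob;
  unt : I ~> mon_ob;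
  mulA : mul ∘ (mul ⊠ idm _) = mul ∘ (idm _ ⊠ mul) ∘ assoc _ _ _;
  mul1m : mul ∘ (unt ⊠ idm _) = lunit _;
  mulm1 : mul ∘ (idm _ ⊠ unt) = runit _
}.

Record monoid_hom (A B : monoid) := MonoidHom {
  mon_fun :> A ~> B;
  mon_fun_mul : mon_fun ∘ mul A = mul B ∘ (mon_fun ⊠ mon_fun);
  mon_fun_unt : mon_fun ∘ unt A = unt B
}.

Record comonoid := Comonoid {
  com_ob :> V;
  comul : com_ob ~> com_ob ⊗ com_ob;
  counit : com_ob ~> I;
  comulA : assoc _ _ _ ∘ (comul ⊠ idm _) ∘ comul = (idm _ ⊠ comul) ∘ comul;
  comul1m : lunit _ ∘ (counit ⊠ idm _) ∘ comul = idm _;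
  comulm1 : runit _ ∘ (idm _ ⊠ counit) ∘ comul = idm _
}.

Record comonoid_hom (C D : comonoid) := ComonoidHom {
  com_fun :> C ~> D;
  com_fun_comul : comul D ∘ com_fun = (com_fun ⊠ com_fun) ∘ comul C;
  com_fun_counit : counit D ∘ com_fun = counit C
}.

Record rmodule (A : monoid) := Rmodule {
  rmod_ob :> V;
  act : rmod_ob ⊗ A ~> rmod_ob;
  actA : act ∘ (act ⊠ idm _) = act ∘ (idm _ ⊠ mul A) ∘ assoc _ _ _;
  act1 : act ∘ (idm _ ⊠ unt A) = runit _
}.

Record rcomodule (C : comonoid) := Rcomodule {
  rcom_ob :> V;
  coact : rcom_ob ~> rcom_ob ⊗ C;
  coactA : assoc _ _ _ ∘ (coact ⊠ idm _) ∘ coact = (idm _ ⊠ comul C) ∘ coact;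
  coact1 : runit _ ∘ (idm _ ⊠ counit C) ∘ coact = idm _
}.

(* The monoid, resp. comonoid, is part of the data: these are the objects [M_A]
   and [X_C] of the global categories. *)
Record gmodule := Gmodule {
  gmod_mon : monoid;
  gmod_mod :> rmodule gmod_mon
}.

Record gmodule_hom (M N : gmodule) := GmoduleHom {
  gmod_fun :> M ~> N;
  gmod_mfun : monoid_hom (gmod_mon M) (gmod_mon N);
  gmod_fun_act : gmod_fun ∘ act M = act N ∘ (gmod_fun ⊠ gmod_mfun)
}.

Record gcomodule := Gcomodule {
  underlying_comonoid : comonoid;
  gcom_com :> rcomodule underlying_comonoid
}.

Record gcomodule_hom (X Y : gcomodule) := GcomoduleHom {
  gcom_fun :> X ~> Y;
  gcom_cfun : comonoid_hom (underlying_comonoid X) (underlying_comonoid Y);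
  gcom_fun_coact : coact Y ∘ gcom_fun = (gcom_fun ⊠ gcom_cfun) ∘ coact X
}.

End Structures.

Arguments mul {_} _.
Arguments unt {_} _.
Arguments comul {_} _.
Arguments counit {_} _.
Arguments act {_ _} _.
Arguments coact {_ _} _.
Arguments Gmodule {_ _} _.
Arguments Gcomodule {_ _} _.

Lemma monoid_hom_eq (V : monoidal_category) (A B : monoid V)
  (f g : monoid_hom A B) : f = g :> (A ~> B) -> f = g.
Proof.
case: f => f f1 f2; case: g => g g1 g2 /= e; subst g.
by rewrite (proof_irrelevance _ f1 g1) (proof_irrelevance _ f2 g2).
Qed.

Lemma comonoid_hom_eq (V : monoidal_category) (C D : comonoid V)
  (f g : comonoid_hom C D) : f = g :> (C ~> D) -> f = g.
Proof.
case: f => f f1 f2; case: g => g g1 g2 /= e; subst g.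
by rewrite (proof_irrelevance _ f1 g1) (proof_irrelevance _ f2 g2).
Qed.

Lemma gmodule_hom_eq (V : monoidal_category) (M N : gmodule V)
  (p q : gmodule_hom M N) :
  p = q :> (M ~> N) -> gmod_mfun p = gmod_mfun q -> p = q.
Proof.
case: p => p f h; case: q => q g k /= e1 e2; subst q g.
by rewrite (proof_irrelevance _ h k).
Qed.

Lemma gcomodule_hom_eq (V : monoidal_category) (X Y : gcomodule V)
  (k l : gcomodule_hom X Y) :
  k = l :> (X ~> Y) -> gcom_cfun k = gcom_cfun l -> k = l.
Proof.
case: k => p f h; case: l => q g k /= e1 e2; subst q g.
by rewrite (proof_irrelevance _ h k).
Qed.

Section Categories.
Variable V : monoidal_category.

Lemma tensor_compl (X X' X'' Y Y' : V) (f' : X' ~> X'') (f : X ~> X')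
    (g : Y ~> Y') :
  (f' ∘ f) ⊠ g = (f' ⊠ g) ∘ (f ⊠ idm _).
Proof. by rewrite -tensor_comp compm1. Qed.

Program Definition monoid_id (A : monoid V) : monoid_hom A A :=
  {| mon_fun := idm A |}.
Next Obligation. by move=> A; rewrite tensor_id comp1m compm1. Qed.
Next Obligation. by move=> A; rewrite comp1m. Qed.

Program Definition monoid_comp (A B C : monoid V) (g : monoid_hom B C)
    (f : monoid_hom A B) : monoid_hom A C := {| mon_fun := g ∘ f |}.
Next Obligation.
by move=> A B C g f; rewrite -compA mon_fun_mul compA mon_fun_mul tensor_comp compA.
Qed.
Next Obligation. by move=> A B C g f; rewrite -compA !mon_fun_unt. Qed.

Program Definition Mon : category :=
  {| ob := monoid V; hom := @monoid_hom V; idm := monoid_id;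
     comp := monoid_comp |}.
Next Obligation. by move=> *; apply: monoid_hom_eq; apply: compA. Qed.
Next Obligation. by move=> *; apply: monoid_hom_eq; apply: comp1m. Qed.
Next Obligation. by move=> *; apply: monoid_hom_eq; apply: compm1. Qed.

Program Definition comonoid_id (C : comonoid V) : comonoid_hom C C :=
  {| com_fun := idm C |}.
Next Obligation. by move=> C; rewrite tensor_id comp1m compm1. Qed.
Next Obligation. by move=> C; rewrite compm1. Qed.

Program Definition comonoid_comp (C D E : comonoid V) (g : comonoid_hom D E)
    (f : comonoid_hom C D) : comonoid_hom C E := {| com_fun := g ∘ f |}.
Next Obligation.
move=> C D E g f.
by rewrite compA com_fun_comul -compA com_fun_comul tensor_comp compA.
Qed.
Next Obligation. by move=> C D E g f; rewrite compA !com_fun_counit. Qed.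

Program Definition Comon : category :=
  {| ob := comonoid V; hom := @comonoid_hom V; idm := comonoid_id;
     comp := comonoid_comp |}.
Next Obligation. by move=> *; apply: comonoid_hom_eq; apply: compA. Qed.
Next Obligation. by move=> *; apply: comonoid_hom_eq; apply: comp1m. Qed.
Next Obligation. by move=> *; apply: comonoid_hom_eq; apply: compm1. Qed.

Program Definition gmodule_id (M : gmodule V) : gmodule_hom M M :=
  {| gmod_fun := idm M; gmod_mfun := monoid_id _ |}.
Next Obligation. by move=> M; rewrite tensor_id comp1m compm1. Qed.

Program Definition gmodule_comp (M N P : gmodule V) (q : gmodule_hom N P)
    (p : gmodule_hom M N) : gmodule_hom M P :=
  {| gmod_fun := q ∘ p;
     gmod_mfun := monoid_comp (gmod_mfun q) (gmod_mfun p) |}.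
Next Obligation.
move=> M N P q p.
by rewrite -compA gmod_fun_act compA gmod_fun_act tensor_comp compA.
Qed.

Program Definition Mod : category :=
  {| ob := gmodule V; hom := @gmodule_hom V; idm := gmodule_id;
     comp := gmodule_comp |}.
Next Obligation.
by move=> *; apply: gmodule_hom_eq; [apply: compA | apply: (compA (c:=Mon))].
Qed.
Next Obligation.
by move=> *; apply: gmodule_hom_eq; [apply: comp1m | apply: (comp1m (c:=Mon))].
Qed.
Next Obligation.
by move=> *; apply: gmodule_hom_eq; [apply: compm1 | apply: (compm1 (c:=Mon))].
Qed.

Program Definition gcomodule_id (X : gcomodule V) : gcomodule_hom X X :=
  {| gcom_fun := idm X; gcom_cfun := comonoid_id _ |}.
Next Obligation. by move=> X; rewrite tensor_id comp1m compm1. Qed.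

Program Definition gcomodule_comp (X Y Z : gcomodule V) (l : gcomodule_hom Y Z)
    (k : gcomodule_hom X Y) : gcomodule_hom X Z :=
  {| gcom_fun := l ∘ k;
     gcom_cfun := comonoid_comp (gcom_cfun l) (gcom_cfun k) |}.
Next Obligation.
move=> X Y Z l k.
by rewrite compA gcom_fun_coact -compA gcom_fun_coact tensor_comp compA.
Qed.

Program Definition Comod : category :=
  {| ob := gcomodule V; hom := @gcomodule_hom V; idm := gcomodule_id;
     comp := gcomodule_comp |}.
Next Obligation.
by move=> *; apply: gcomodule_hom_eq; [apply: compA | apply: (compA (c:=Comon))].
Qed.
Next Obligation.
by move=> *; apply: gcomodule_hom_eq; [apply: comp1m | apply: (comp1m (c:=Comon))].
Qed.
Next Obligation.
by move=> *; apply: gcomodule_hom_eq; [apply: compm1 | apply: (compm1 (c:=Comon))].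
Qed.

End Categories.

Section Coherence.
Variable V : braided_category.
Local Notation I := (@munit V).

Lemma cancel_pre (C : category) (X Y Z : C) (e : X ~> Y) (e' : Y ~> X)
    (f g : Y ~> Z) : e ∘ e' = idm _ -> f ∘ e = g ∘ e -> f = g.
Proof. by move=> ee' fg; rewrite -(compm1 f) -ee' compA fg -compA ee' compm1. Qed.

Lemma cancel_post (C : category) (X Y Z : C) (e : Y ~> Z) (e' : Z ~> Y)
    (f g : X ~> Y) : e' ∘ e = idm _ -> e ∘ f = e ∘ g -> f = g.
Proof. by move=> ee' fg; rewrite -(comp1m f) -ee' -compA fg compA ee' comp1m. Qed.

(* Rewriting under right-nested composites. *)
Lemma reassoc (C : category) (X Y Y' Z : C) (f : Y ~> Z) (g : X ~> Y)
    (h : X ~> Z) : f ∘ g = h -> forall k : Y' ~> X, f ∘ (g ∘ k) = h ∘ k.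
Proof. by move=> <- k; rewrite compA. Qed.

Lemma reassoc3 (C : category) (X Y Y' Z W : C) (f : Z ~> W) (g : Y ~> Z)
    (h : X ~> Y) (m : X ~> W) :
  f ∘ g ∘ h = m -> forall k : Y' ~> X, f ∘ (g ∘ (h ∘ k)) = m ∘ k.
Proof. by move=> <- k; rewrite !compA. Qed.

Lemma tcomp1l (X Y Y' Y'' : V) (g' : Y' ~> Y'') (g : Y ~> Y') :
  idm X ⊠ (g' ∘ g) = (idm X ⊠ g') ∘ (idm X ⊠ g).
Proof. by rewrite -tensor_comp comp1m. Qed.

Lemma tcomp1r (X Y Y' Y'' : V) (g' : Y' ~> Y'') (g : Y ~> Y') :
  (g' ∘ g) ⊠ idm X = (g' ⊠ idm X) ∘ (g ⊠ idm X).
Proof. by rewrite -tensor_comp comp1m. Qed.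

Lemma interchange (X X' Y Y' : V) (f : X ~> X') (g : Y ~> Y') :
  (f ⊠ idm _) ∘ (idm _ ⊠ g) = (idm _ ⊠ g) ∘ (f ⊠ idm _).
Proof. by rewrite -!tensor_comp !comp1m !compm1. Qed.

Lemma associ_nat (X X' Y Y' Z Z' : V) (f : X ~> X') (g : Y ~> Y') (h : Z ~> Z') :
  associ X' Y' Z' ∘ (f ⊠ (g ⊠ h)) = ((f ⊠ g) ⊠ h) ∘ associ X Y Z.
Proof.
apply: (cancel_post (assocK _ _ _)).
by rewrite !compA assocVK comp1m assoc_nat -compA assocVK compm1.
Qed.

Lemma whisker_l (X Y : V) (f g : X ~> Y) :
  idm I ⊠ f = idm I ⊠ g -> f = g.
Proof.
move=> e; apply: (cancel_pre (lunitVK _)); by rewrite -!lunit_nat e.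
Qed.

Lemma whisker_r (X Y : V) (f g : X ~> Y) :
  f ⊠ idm I = g ⊠ idm I -> f = g.
Proof.
move=> e; apply: (cancel_pre (runitVK _)); by rewrite -!runit_nat e.
Qed.

Lemma tassocK (X Y Z W : V) :
  (idm W ⊠ associ X Y Z) ∘ (idm W ⊠ assoc X Y Z) = idm _.
Proof. by rewrite -tcomp1l assocK tensor_id. Qed.

Lemma tassocVK (X Y Z W : V) :
  (idm W ⊠ assoc X Y Z) ∘ (idm W ⊠ associ X Y Z) = idm _.
Proof. by rewrite -tcomp1l assocVK tensor_id. Qed.

Lemma assocrVK (X Y Z W : V) :
  (assoc X Y Z ⊠ idm W) ∘ (associ X Y Z ⊠ idm W) = idm _.
Proof. by rewrite -tcomp1r assocVK tensor_id. Qed.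

Lemma assocrK (X Y Z W : V) :
  (associ X Y Z ⊠ idm W) ∘ (assoc X Y Z ⊠ idm W) = idm _.
Proof. by rewrite -tcomp1r assocK tensor_id. Qed.

Lemma lunit_tensor (X Y : V) : lunit (X ⊗ Y) ∘ assoc I X Y = lunit X ⊠ idm Y.
Proof.
apply: whisker_l; rewrite tcomp1l.
have e1 : (assoc I (I ⊗ X) Y ∘ (assoc I I X ⊠ idm Y))
   ∘ ((associ I I X ⊠ idm Y) ∘ associ I (I ⊗ X) Y) = idm _.
  by rewrite -!compA (reassoc (assocrVK _ _ _ _)) comp1m assocVK.
apply: (cancel_pre e1).
rewrite -[LHS]compA [X in _ ∘ X]compA -pentagon compA triangle.
rewrite [RHS]compA -assoc_nat -compA -tcomp1r triangle.
by rewrite -tensor_id assoc_nat.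
Qed.

Lemma runit_tensor (X Y : V) : (idm X ⊠ runit Y) ∘ assoc X Y I = runit (X ⊗ Y).
Proof.
apply: whisker_r; rewrite tcomp1r.
apply: (cancel_post (assocK _ _ _)).
rewrite compA assoc_nat -triangle -compA tcomp1l -!compA.
rewrite (compA (idm X ⊠ assoc _ _ _)).
by rewrite -pentagon -[in RHS]triangle -tensor_id !compA assoc_nat.
Qed.

Lemma runit_munit : runit I = lunit I.
Proof.
apply: whisker_r; rewrite -triangle -lunit_tensor.
congr (_ ∘ _); apply: (cancel_post (lunitK _)); by rewrite lunit_nat.
Qed.

Lemma lunit_lunit (X : V) : idm I ⊠ lunit X = lunit (I ⊗ X).
Proof. by apply: (cancel_post (lunitK _)); rewrite lunit_nat. Qed.

Lemma runit_runit (X : V) : runit X ⊠ idm I = runit (X ⊗ I).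
Proof. by apply: (cancel_post (runitK _)); rewrite runit_nat. Qed.

Lemma lunit_associ (X Y : V) : (lunit X ⊠ idm Y) ∘ associ I X Y = lunit (X ⊗ Y).
Proof. by rewrite -lunit_tensor -compA assocVK compm1. Qed.

Lemma runit_associ (X Y : V) : runit (X ⊗ Y) ∘ associ X Y I = idm X ⊠ runit Y.
Proof. by rewrite -runit_tensor -compA assocVK compm1. Qed.

Lemma triangle_associ (X Y : V) :
  (runit X ⊠ idm Y) ∘ associ X I Y = idm X ⊠ lunit Y.
Proof. by rewrite -triangle -compA assocVK compm1. Qed.

Lemma braid_lunit (X : V) : runit X ∘ braid I X = lunit X.
Proof.
apply: whisker_r.
have bK : (idm I ⊠ braid I X) ∘ (idm I ⊠ braidi I X) = idm _.
  by rewrite -tcomp1l braidVK tensor_id.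
rewrite tcomp1r.
apply: (cancel_pre (assocK _ _ _)).
apply: (cancel_pre bK).
have := hexagon2 I I X; rewrite -!compA => <-.
rewrite (reassoc (triangle_associ _ _)) (reassoc (lunit_associ _ _)).
by rewrite (reassoc (esym (braid_nat _ _))) -compA lunit_associ lunit_nat.
Qed.

Lemma braid_runit (X : V) : lunit X ∘ braid X I = runit X.
Proof.
apply: whisker_l.
have bK : (braid X I ⊠ idm I) ∘ (braidi X I ⊠ idm I) = idm _.
  by rewrite -tcomp1r braidVK tensor_id.
rewrite tcomp1l.
apply: (cancel_pre (assocVK _ _ _)).
apply: (cancel_pre bK).
have := hexagon1 X I I; rewrite -!compA => <-.
rewrite lunit_lunit (reassoc (lunit_tensor _ _)) (reassoc (runit_tensor _ _)).
rewrite (reassoc (esym (braid_nat _ _))) -compA triangle.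
by rewrite runit_nat runit_runit.
Qed.

Definition pass (W X C : V) : W ⊗ (X ⊗ C) ~> X ⊗ (W ⊗ C) :=
  assoc X W C ∘ (braid W X ⊠ idm C) ∘ associ W X C.

(* The reassociated [idm Z ⊠ braid W X ⊠ idm C]. *)
Definition middle_braid (Z W X C : V) : Z ⊗ W ⊗ (X ⊗ C) ~> Z ⊗ X ⊗ (W ⊗ C) :=
  associ Z X (W ⊗ C) ∘ (idm Z ⊠ pass W X C) ∘ assoc Z W (X ⊗ C).

Lemma pass_nat (W W' X X' C C' : V) (f : W ~> W') (g : X ~> X') (h : C ~> C') :
  pass W' X' C' ∘ (f ⊠ (g ⊠ h)) = (g ⊠ (f ⊠ h)) ∘ pass W X C.
Proof.
rewrite /pass -!compA associ_nat [in RHS]compA -assoc_nat -!compA.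
by rewrite !(compA (_ ⊠ _)) -!tensor_comp braid_nat comp1m compm1.
Qed.

Lemma middle_braid_nat (Z Z' W W' X X' C C' : V)
    (f : Z ~> Z') (g : W ~> W') (h : X ~> X') (k : C ~> C') :
  middle_braid Z' W' X' C' ∘ ((f ⊠ g) ⊠ (h ⊠ k))
  = ((f ⊠ h) ⊠ (g ⊠ k)) ∘ middle_braid Z W X C.
Proof.
rewrite /middle_braid -!compA assoc_nat [in RHS]compA -associ_nat -!compA.
by rewrite !(compA (_ ⊠ _)) -!tensor_comp pass_nat comp1m compm1.
Qed.

Lemma iso_comp (C : category) (X Y Z : C) (e : X ~> Y) (e' : Y ~> X)
    (f : Y ~> Z) (f' : Z ~> Y) :
  e ∘ e' = idm _ -> f ∘ f' = idm _ -> (f ∘ e) ∘ (e' ∘ f') = idm _.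
Proof. by move=> h k; rewrite -compA (reassoc h) comp1m. Qed.

Lemma pass_tensor_r (W X X' T : V) :
  assoc X X' (W ⊗ T) ∘ pass W (X ⊗ X') T
  = (idm X ⊠ pass W X' T) ∘ pass W X (X' ⊗ T) ∘ (idm W ⊠ assoc X X' T).
Proof.
apply: (cancel_pre (iso_comp (assocrVK W X X' T) (assocVK W (X ⊗ X') T))).
rewrite /pass !tcomp1l -!compA.
rewrite [in LHS](reassoc (pentagon _ _ _ _)) (reassoc (assocK _ _ _)) comp1m -!compA.
have := congr1 (fun f => f ⊠ idm T) (hexagon1 W X X').
rewrite !tcomp1r -!compA => ->.
have := pentagon W X X' T; rewrite -!compA => <-.
rewrite (reassoc (assocK _ _ _)) comp1m.
rewrite -tensor_id -assoc_nat (reassoc (assoc_nat _ _ _)) -compA.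
rewrite (reassoc (pentagon _ _ _ _)) -!compA.
by rewrite (reassoc (tassocK _ _ _ _)) comp1m.
Qed.

Lemma pentagon_associ (X Y Z W : V) :
  assoc X Y (Z ⊗ W) ∘ (assoc (X ⊗ Y) Z W ∘ (associ X Y Z ⊠ idm W))
  = (idm X ⊠ assoc Y Z W) ∘ assoc X (Y ⊗ Z) W.
Proof.
by rewrite (reassoc (pentagon _ _ _ _)) -compA assocrVK compm1.
Qed.

Lemma pentagon_tassoci (X Y Z W : V) :
  assoc X (Y ⊗ Z) W ∘ (assoc X Y Z ⊠ idm W)
  = (idm X ⊠ associ Y Z W) ∘ (assoc X Y (Z ⊗ W) ∘ assoc (X ⊗ Y) Z W).
Proof. by rewrite pentagon -!compA (reassoc (tassocK _ _ _ _)) comp1m. Qed.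

Lemma pass_tensor_l (W W' X T : V) :
  (idm X ⊠ assoc W W' T) ∘ pass (W ⊗ W') X T
  = pass W X (W' ⊗ T) ∘ (idm W ⊠ pass W' X T) ∘ assoc W W' (X ⊗ T).
Proof.
apply: (cancel_pre (iso_comp (assocrK W W' X T) (assocVK (W ⊗ W') X T))).
rewrite /pass !tcomp1l -!compA.
rewrite [in LHS](reassoc (assocK _ _ _)) comp1m.
rewrite (reassoc (esym (pentagon_associ _ _ _ _))) -!compA.
have := congr1 (fun f => f ⊠ idm T) (hexagon2 W W' X).
rewrite !tcomp1r -!compA => ->.
rewrite (reassoc (assoc_nat _ _ _)) -compA tensor_id; congr (_ ∘ (_ ∘ _)).
rewrite pentagon_associ (reassoc (tassocK _ _ _ _)) comp1m -assoc_nat.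
rewrite (reassoc (esym (pentagon_associ _ _ _ _))) -!compA.
by rewrite (reassoc (assocK _ _ _)) comp1m.
Qed.

Lemma middle_braid_tensor (Z W X C T : V) :
  assoc Z X (W ⊗ C ⊗ T) ∘ assoc (Z ⊗ X) (W ⊗ C) T ∘ (middle_braid Z W X C ⊠ idm T)
  = (idm Z ⊠ ((idm X ⊠ associ W C T) ∘ pass W X (C ⊗ T) ∘ (idm W ⊠ assoc X C T)))
    ∘ assoc Z W (X ⊗ C ⊗ T) ∘ assoc (Z ⊗ W) (X ⊗ C) T.
Proof.
rewrite /middle_braid !tcomp1r -!compA.
rewrite (reassoc (pentagon _ _ _ _)) -!compA (reassoc (assocrVK _ _ _ _)) comp1m.
rewrite (reassoc (assoc_nat _ _ _)) -compA [in RHS]pentagon.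
rewrite !compA -!tcomp1l; congr (_ ∘ _ ∘ _); congr (_ ⊠ _).
rewrite /pass !tcomp1r -!compA.
rewrite (reassoc (pentagon_tassoci _ _ _ _)) -!compA; congr (_ ∘ (_ ∘ _)).
rewrite (reassoc (assoc_nat _ _ _)) -compA tensor_id; congr (_ ∘ _).
rewrite -[idm W ⊠ _ ∘ _]pentagon_associ.
by rewrite (reassoc (assocK _ _ _)) comp1m.
Qed.

Lemma middle_braid_assoc (Z1 Z2 Z3 X1 X2 X3 : V) :
  assoc (Z1 ⊗ X1) (Z2 ⊗ X2) (Z3 ⊗ X3)
    ∘ (middle_braid Z1 Z2 X1 X2 ⊠ idm _)
    ∘ middle_braid (Z1 ⊗ Z2) Z3 (X1 ⊗ X2) X3
  = (idm _ ⊠ middle_braid Z2 Z3 X2 X3)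
    ∘ middle_braid Z1 (Z2 ⊗ Z3) X1 (X2 ⊗ X3)
    ∘ (assoc Z1 Z2 Z3 ⊠ assoc X1 X2 X3).
Proof.
apply: (cancel_post (assocK Z1 X1 _)).
rewrite -!compA (reassoc3 (middle_braid_tensor _ _ _ _ _)) /middle_braid.
(* [pass] is generalized so that [compA] does not unfold it. *)
move: (pass_nat) (pass_tensor_r) (pass_tensor_l).
move: pass => p p_nat p_tensor_r p_tensor_l.
rewrite -!compA (reassoc (assocVK _ _ _)) comp1m.
rewrite -(tensor_id Z1 Z2) [in LHS](reassoc (assoc_nat _ _ _)) -!compA.
rewrite -(tensor_id Z1 X1) [in RHS](reassoc (assoc_nat _ _ _)) -!compA.
rewrite [in RHS](reassoc (assocVK _ _ _)) comp1m.
have -> : assoc Z1 Z2 Z3 ⊠ assoc X1 X2 X3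
    = (idm _ ⊠ assoc X1 X2 X3) ∘ (assoc Z1 Z2 Z3 ⊠ idm _).
  by rewrite -tensor_comp comp1m compm1.
rewrite -(tensor_id Z1 (Z2 ⊗ Z3)) [in RHS](reassoc (assoc_nat _ _ _)).
rewrite pentagon !compA -!tcomp1l -!compA.
congr ((_ ⊠ _) ∘ _).
rewrite (compA (idm Z2 ⊠ _)) -tcomp1l p_tensor_r !tcomp1l -!compA.
rewrite (reassoc (p_nat _ _ _ _ _ _ _ _ _)) -!compA.
rewrite [in RHS](reassoc (p_tensor_l _ _ _ _)) -!compA.
by rewrite -(tensor_id Z2 Z3) assoc_nat.
Qed.

Lemma middle_braid_runit (Z X : V) :
  runit (Z ⊗ X) ∘ (idm _ ⊠ lunit I) ∘ middle_braid Z I X I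
  = runit Z ⊠ runit X.
Proof.
rewrite /middle_braid -(tensor_id Z X) -!compA.
rewrite (reassoc (esym (associ_nat _ _ _))) -!compA.
rewrite (reassoc (runit_associ _ _)) !compA -!tcomp1l -!compA /pass -!compA.
rewrite (reassoc (triangle _ _)).
rewrite (reassoc (esym (tcomp1r _ _ _))) braid_lunit lunit_associ -lunit_nat.
rewrite tcomp1l -compA -assoc_nat tensor_id (reassoc (triangle _ _)).
by rewrite -tensor_comp comp1m compm1.
Qed.

Lemma middle_braid_lunit (W C : V) :
  lunit (W ⊗ C) ∘ (lunit I ⊠ idm _) ∘ middle_braid I W I C
  = lunit W ⊠ lunit C.
Proof.
rewrite /middle_braid -!compA (reassoc (lunit_associ _ _)).
rewrite (reassoc (lunit_nat _)) -compA lunit_tensor /pass -!compA.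
rewrite (reassoc (lunit_tensor _ _)) (reassoc (esym (tcomp1r _ _ _))).
rewrite braid_runit (reassoc (triangle_associ _ _)).
by rewrite -tensor_comp comp1m compm1.
Qed.

Lemma middle_braid_assoc' (Z1 Z2 Z3 X1 X2 X3 : V) :
  (middle_braid Z1 Z2 X1 X2 ⊠ idm _)
    ∘ middle_braid (Z1 ⊗ Z2) Z3 (X1 ⊗ X2) X3
  = associ (Z1 ⊗ X1) (Z2 ⊗ X2) (Z3 ⊗ X3)
    ∘ (idm _ ⊠ middle_braid Z2 Z3 X2 X3)
    ∘ middle_braid Z1 (Z2 ⊗ Z3) X1 (X2 ⊗ X3)
    ∘ (assoc Z1 Z2 Z3 ⊠ assoc X1 X2 X3).
Proof.
apply: (cancel_post (assocK _ _ _)); rewrite compA middle_braid_assoc.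
by rewrite -!compA (reassoc (assocVK _ _ _)) comp1m.
Qed.

End Coherence.

Section Convolution.
Variable V : bmc_category.
Local Notation I := (@munit V).

Lemma curry_inj (X Y Z : V) (f g : Z ~> ihom X Y) :
  ev X Y ∘ (f ⊠ idm X) = ev X Y ∘ (g ⊠ idm X) -> f = g.
Proof. by move=> e; rewrite -(curry_uniq f) e curry_uniq. Qed.

(* Unlike [rewrite -!compA], does not unfold definitions. *)
Ltac nest_right :=
  repeat match goal with |- context [comp (comp ?h ?g) ?f] =>
    rewrite -(compA h g f) end.

Definition conv (X N C B Z W : V) (chi : X ~> X ⊗ C) (mu : N ⊗ B ~> N)
    (f : Z ⊗ X ~> N) (g : W ⊗ C ~> B) : Z ⊗ W ⊗ X ~> N :=
  mu ∘ (f ⊠ g) ∘ middle_braid Z W X C ∘ (idm (Z ⊗ W) ⊠ chi).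

(* Gives the multiplication of [C, B] for the comultiplication [chi] and the
   multiplication [mu], and the action of [C, B] on [X, N] for the coaction [chi]
   and the action [mu]. *)
Definition convolution (X N C B : V) (chi : X ~> X ⊗ C) (mu : N ⊗ B ~> N) :
    ihom X N ⊗ ihom C B ~> ihom X N :=
  curry (conv chi mu (ev X N) (ev C B)).

Definition conv_unit (C : comonoid V) (B : monoid V) : I ~> ihom C B :=
  curry (unt B ∘ counit C ∘ lunit C).

Definition precomp (X Y N : V) (k : X ~> Y) : ihom Y N ~> ihom X N :=
  curry (ev Y N ∘ (idm (ihom Y N) ⊠ k)).

Lemma conv_nat (X N C B Z Z' W W' : V) (chi : X ~> X ⊗ C) (mu : N ⊗ B ~> N)
    (f : Z' ⊗ X ~> N) (g : W' ⊗ C ~> B) (a : Z ~> Z') (b : W ~> W') :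
  conv chi mu (f ∘ (a ⊠ idm X)) (g ∘ (b ⊠ idm C))
  = conv chi mu f g ∘ ((a ⊠ b) ⊠ idm X).
Proof.
rewrite /conv tensor_comp; nest_right; rewrite (reassoc (esym (middle_braid_nat _ _ _ _))).
by nest_right; rewrite tensor_id -!interchange.
Qed.

Lemma conv_natl (X N C B Z Z' W : V) (chi : X ~> X ⊗ C) (mu : N ⊗ B ~> N)
    (f : Z' ⊗ X ~> N) (g : W ⊗ C ~> B) (a : Z ~> Z') :
  conv chi mu (f ∘ (a ⊠ idm X)) g = conv chi mu f g ∘ ((a ⊠ idm W) ⊠ idm X).
Proof. by rewrite -conv_nat tensor_id compm1. Qed.

Lemma conv_natr (X N C B Z W W' : V) (chi : X ~> X ⊗ C) (mu : N ⊗ B ~> N)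
    (f : Z ⊗ X ~> N) (g : W' ⊗ C ~> B) (b : W ~> W') :
  conv chi mu f (g ∘ (b ⊠ idm C)) = conv chi mu f g ∘ ((idm Z ⊠ b) ⊠ idm X).
Proof. by rewrite -conv_nat tensor_id compm1. Qed.

Lemma conv_assoc (C : comonoid V) (B : monoid V) (X : rcomodule C)
    (N : rmodule B) (Z1 Z2 Z3 : V) (f : Z1 ⊗ X ~> N) (g : Z2 ⊗ C ~> B)
    (h : Z3 ⊗ C ~> B) :
  conv (coact X) (act N) (conv (coact X) (act N) f g) h
  = conv (coact X) (act N) f (conv (comul C) (mul B) g h)
    ∘ (assoc Z1 Z2 Z3 ⊠ idm X).
Proof.
rewrite /conv.
have -> : (act N ∘ (f ⊠ g) ∘ middle_braid Z1 Z2 X C ∘ (idm _ ⊠ coact X)) ⊠ h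
  = (act N ⊠ idm _) ∘ ((f ⊠ g) ⊠ h) ∘ (middle_braid Z1 Z2 X C ⊠ idm _)
    ∘ ((idm _ ⊠ coact X) ⊠ (idm _ ⊠ idm _)).
  by rewrite tensor_id -!tensor_comp !compm1 comp1m.
have -> : f ⊠ (mul B ∘ (g ⊠ h) ∘ middle_braid Z2 Z3 C C ∘ (idm _ ⊠ comul C))
  = (idm _ ⊠ mul B) ∘ (f ⊠ (g ⊠ h)) ∘ (idm _ ⊠ middle_braid Z2 Z3 C C)
    ∘ ((idm _ ⊠ idm _) ⊠ (idm _ ⊠ comul C)).
  by rewrite tensor_id -!tensor_comp !compm1 comp1m.
nest_right; rewrite (reassoc (esym (middle_braid_nat _ _ _ _))).
nest_right; rewrite (reassoc (middle_braid_assoc' _ _ _ _ _ _)); nest_right.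
rewrite (reassoc (esym (associ_nat _ _ _))) (reassoc (actA N)); nest_right.
rewrite (reassoc (assocVK _ _ _)) comp1m; congr (_ ∘ (_ ∘ (_ ∘ (_ ∘ _)))).
rewrite (reassoc (esym (middle_braid_nat _ _ _ _))); nest_right.
congr (_ ∘ _); rewrite !tensor_id -!tensor_comp !compm1 !comp1m compA coactA.
by [].
Qed.

Lemma conv_unitr (C : comonoid V) (B : monoid V) (X : rcomodule C)
    (N : rmodule B) (Z : V) (f : Z ⊗ X ~> N) :
  conv (coact X) (act N) f (unt B ∘ counit C ∘ lunit C)
  = f ∘ (runit Z ⊠ idm X).
Proof.
rewrite /conv.
have -> : f ⊠ (unt B ∘ counit C ∘ lunit C)
  = (idm _ ⊠ unt B) ∘ (f ⊠ idm _) ∘ (idm _ ⊠ lunit I) ∘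
    ((idm _ ⊠ idm _) ⊠ (idm _ ⊠ counit C)).
  by rewrite tensor_id -!tensor_comp !compm1 !comp1m; nest_right; rewrite lunit_nat.
nest_right; rewrite (reassoc (esym (middle_braid_nat _ _ _ _))); nest_right.
rewrite (reassoc (act1 N)) (reassoc (runit_nat _)); nest_right.
rewrite (reassoc3 (middle_braid_runit _ _)) !tensor_id -!tensor_comp compm1.
by rewrite compA coact1 !compm1.
Qed.

Lemma conv_unitl (C : comonoid V) (B : monoid V) (W : V) (g : W ⊗ C ~> B) :
  conv (comul C) (mul B) (unt B ∘ counit C ∘ lunit C) g
  = g ∘ (lunit W ⊠ idm C).
Proof.
rewrite /conv.
have -> : (unt B ∘ counit C ∘ lunit C) ⊠ g
  = (unt B ⊠ idm _) ∘ (idm _ ⊠ g) ∘ (lunit I ⊠ idm _) ∘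
    ((idm _ ⊠ counit C) ⊠ (idm _ ⊠ idm _)).
  by rewrite tensor_id -!tensor_comp !compm1 !comp1m; nest_right; rewrite lunit_nat.
nest_right; rewrite (reassoc (esym (middle_braid_nat _ _ _ _))); nest_right.
rewrite (reassoc (mul1m B)) (reassoc (lunit_nat _)); nest_right.
rewrite (reassoc3 (middle_braid_lunit _ _)) !tensor_id -!tensor_comp compm1.
by rewrite compA comul1m !compm1.
Qed.

Definition self_comodule (C : comonoid V) : rcomodule C :=
  {| coact := comul C; coactA := comulA C; coact1 := comulm1 C |}.

Definition self_module (B : monoid V) : rmodule B :=
  {| act := mul B; actA := mulA B; act1 := mulm1 B |}.

Lemma convolution_assoc (C : comonoid V) (B : monoid V) (X : rcomodule C)
    (N : rmodule B) :
  convolution (coact X) (act N) ∘ (convolution (coact X) (act N) ⊠ idm _)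
  = convolution (coact X) (act N)
    ∘ (idm _ ⊠ convolution (comul C) (mul B)) ∘ assoc _ _ _.
Proof.
apply: curry_inj; rewrite !tcomp1r !compA {1 3}/convolution !curryK.
rewrite -conv_natl -conv_natr /convolution !curryK.
exact: conv_assoc.
Qed.

Lemma convolution_unitr (C : comonoid V) (B : monoid V) (X : rcomodule C)
    (N : rmodule B) :
  convolution (coact X) (act N) ∘ (idm _ ⊠ conv_unit C B) = runit _.
Proof.
apply: curry_inj; rewrite tcomp1r compA curryK -conv_natr curryK.
exact: conv_unitr.
Qed.

Lemma convolution_unitl (C : comonoid V) (B : monoid V) :
  convolution (comul C) (mul B) ∘ (conv_unit C B ⊠ idm _) = lunit _.
Proof.
apply: curry_inj; rewrite tcomp1r compA curryK -conv_natl curryK.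
exact: conv_unitl.
Qed.

Definition conv_monoid (C : comonoid V) (B : monoid V) : monoid V :=
  {| mon_ob := ihom C B;
     mul := convolution (comul C) (mul B);
     unt := conv_unit C B;
     mulA := convolution_assoc (self_comodule C) (self_module B);
     mul1m := convolution_unitl C B;
     mulm1 := convolution_unitr (self_comodule C) (self_module B) |}.

Definition conv_module (C : comonoid V) (B : monoid V) (X : rcomodule C)
    (N : rmodule B) : rmodule (conv_monoid C B) :=
  @Rmodule V (conv_monoid C B) (ihom X N) (convolution (coact X) (act N))
    (convolution_assoc X N) (convolution_unitr X N).

Lemma precomp_id (X N : V) : precomp N (idm X) = idm _.
Proof. by apply: curry_inj; rewrite curryK. Qed.

Lemma precomp_comp (X Y Z N : V) (l : Y ~> Z) (k : X ~> Y) :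
  precomp N (l ∘ k) = precomp N k ∘ precomp N l.
Proof.
apply: curry_inj; rewrite curryK tcomp1r compA curryK -compA -interchange.
by rewrite compA curryK tcomp1l compA.
Qed.

Lemma precomp_convolution (X Y C D N B : V) (chiX : X ~> X ⊗ C)
    (chiY : Y ~> Y ⊗ D) (mu : N ⊗ B ~> N) (k : X ~> Y) (g : C ~> D) :
  chiY ∘ k = (k ⊠ g) ∘ chiX ->
  precomp N k ∘ convolution chiY mu
  = convolution chiX mu ∘ (precomp N k ⊠ precomp B g).
Proof.
move=> e; apply: curry_inj; rewrite !tcomp1r !compA !curryK -conv_nat !curryK.
rewrite -compA -interchange compA curryK /conv; nest_right.
rewrite -tcomp1l e tcomp1l tensor_comp; nest_right; congr (_ ∘ (_ ∘ _)).
by rewrite (reassoc (esym (middle_braid_nat _ _ _ _))); nest_right; rewrite !tensor_id.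
Qed.

Lemma precomp_unit (C D : comonoid V) (B : monoid V) (g : comonoid_hom C D) :
  precomp B g ∘ conv_unit D B = conv_unit C B.
Proof.
apply: curry_inj; rewrite tcomp1r compA !curryK -compA -interchange compA curryK.
by rewrite -!compA lunit_nat (reassoc (com_fun_counit g)).
Qed.

Definition conv_monoid_map (B : monoid V) (C D : comonoid V)
    (g : comonoid_hom C D) : monoid_hom (conv_monoid D B) (conv_monoid C B) :=
  @MonoidHom V (conv_monoid D B) (conv_monoid C B) (precomp B g)
    (precomp_convolution (mul B) (com_fun_comul g)) (precomp_unit B g).

Program Definition conv_monoid_functor (B : monoid V) :
    contrafunctor (Comon V) (Mon V) :=
  {| fob := fun C : comonoid V => conv_monoid C B : Mon V;
     fmap := fun C D g => conv_monoid_map B g |}.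
Next Obligation. by move=> B C; apply: monoid_hom_eq; apply: precomp_id. Qed.
Next Obligation. by move=> *; apply: monoid_hom_eq; apply: precomp_comp. Qed.

Definition conv_gmodule (N : gmodule V) (X : gcomodule V) : gmodule V :=
  Gmodule (conv_module X N).

Definition conv_gmodule_map (N : gmodule V) (X Y : gcomodule V)
    (k : gcomodule_hom X Y) :
    gmodule_hom (conv_gmodule N Y) (conv_gmodule N X) :=
  @GmoduleHom V (conv_gmodule N Y) (conv_gmodule N X) (precomp N k)
    (conv_monoid_map (gmod_mon N) (gcom_cfun k))
    (precomp_convolution (act N) (gcom_fun_coact k)).

Program Definition conv_gmodule_functor (N : gmodule V) :
    contrafunctor (Comod V) (Mod V) :=
  {| fob := fun X : gcomodule V => conv_gmodule N X : Mod V;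
     fmap := fun X Y k => conv_gmodule_map N k |}.
Next Obligation.
move=> N X; apply: gmodule_hom_eq; first exact: precomp_id.
by apply: monoid_hom_eq; apply: precomp_id.
Qed.
Next Obligation.
move=> N X Y Z l k; apply: gmodule_hom_eq; first exact: precomp_comp.
by apply: monoid_hom_eq; apply: precomp_comp.
Qed.

Definition is_universal_measuring_comonoid (A B : monoid V) (P : comonoid V)
    : Prop :=
  @represents (Comon V) (Mon V) (conv_monoid_functor B) A P.

Definition is_universal_measuring_comodule (A B : monoid V) (M : rmodule A)
    (N : rmodule B) (Q : gcomodule V) : Prop :=
  @represents (Comod V) (Mod V) (conv_gmodule_functor (Gmodule N)) (Gmodule M) Q.

End Convolution.

(* Main.v *)
From mathcomp Require Import ssreflect ssrfun ssrbool.
Require Import Defs.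

Set Implicit Arguments.
Unset Strict Implicit.
Unset Printing Implicit Defensive.

Local Open Scope cat_scope.

(** Let [O] be initial. Then [O] is in exactly one way a comodule [O_C] over any
comonoid [C]: the coaction [O ~> O ⊗ C] is the initial map, and the comodule laws
are equations between maps out of [O]. In the universal property of
[Q = Q(M, N)] at [O_C], both sides lose their object components:
- a comodule morphism [O_C ~> Q] is just a comonoid morphism from [C] to the
  underlying comonoid [P] of [Q] ([bijective_gcom_cfun]);
- [O ⊗ Z] is initial for every [Z] because [- ⊗ Z] is a left adjoint, hence so is
  [Z ⊗ O] by the braiding; therefore [ihom O N] is terminal, and a module morphism from [M] over [A] to [ihom O N]
  over [ihom C B] is just a monoid morphism [A ~> ihom C B]
  ([bijective_gmod_mfun]).
Hence the bijection [Comod(O_C, Q) ≅ Mod(M, ihom O N)] becomes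
[Comon(C, P) ≅ Mon(A, ihom C B)].

The initial maps are only known to exist, so the bijection is not built from
them. It is given by the universal element of [P], the monoid part
[A ~> ihom P B] of the universal element [M ~> ihom Q N] of [Q]; naturality is
then automatic ([represents_of_element]), and [O_C] serves only to check
bijectivity one comonoid at a time. *)

(** Half of the Yoneda lemma: a representation is determined by its value at the
identity. *)
Lemma representation_element (C D : category) (F : contrafunctor C D) (d : D)
    (P : C) (phi : forall X : C, (X ~> P) -> (d ~> F X)) :
  (forall (X Y : C) (g : X ~> Y) (h : Y ~> P),
     phi X (h ∘ g) = fmap F g ∘ phi Y h) ->
  forall (X : C) (h : X ~> P), phi X h = fmap F h ∘ phi P (idm P).
Proof. by move=> phi_nat X h; rewrite -phi_nat comp1m. Qed.

Lemma represents_of_element (C D : category) (F : contrafunctor C D) (d : D)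
    (P : C) (u : d ~> F P) :
  (forall X : C, bijective (fun h : X ~> P => fmap F h ∘ u)) -> represents F d P.
Proof.
move=> u_bij; exists (fun X h => fmap F h ∘ u); split=> // X Y g h.
by rewrite fmap_comp compA.
Qed.

Definition is_terminal (C : category) (T : C) : Prop :=
  forall X : C, exists f : X ~> T, forall g : X ~> T, g = f.

Lemma initial_eq (C : category) (O X : C) (f g : O ~> X) :
  is_initial O -> f = g.
Proof. by move=> /(_ X) [h hE]; rewrite (hE f) (hE g). Qed.

Lemma terminal_eq (C : category) (T X : C) (f g : X ~> T) :
  is_terminal T -> f = g.
Proof. by move=> /(_ X) [h hE]; rewrite (hE f) (hE g). Qed.

Section InitialObject.
Variables (V : bmc_category) (O : V) (O_init : is_initial O).

(** [- ⊗ Z] preserves initial objects as a left adjoint, and the braiding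
carries this over to [Z ⊗ -]. *)
Lemma initial_tensor (Z : V) : is_initial (Z ⊗ O).
Proof.
move=> X; have [f _] := O_init (ihom Z X).
exists (ev Z X ∘ (f ⊠ idm Z) ∘ braid Z O) => g.
apply: (cancel_pre (braidK Z O)); rewrite -compA braidVK compm1.
rewrite -[g ∘ _]curryK; congr (_ ∘ (_ ⊠ _)).
exact: initial_eq.
Qed.

Lemma terminal_ihom (N : V) : is_terminal (ihom O N).
Proof.
move=> Z; have [f fE] := initial_tensor Z N.
by exists (curry f) => g; apply: curry_inj; rewrite curryK; apply: fE.
Qed.

Lemma initial_rcomodule (C : comonoid V) :
  exists X : rcomodule C, rcom_ob X = O.
Proof.
have [chi _] := O_init (O ⊗ C).
by exists (@Rcomodule V C O chi (initial_eq _ _ O_init) (initial_eq _ _ O_init)).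
Qed.

End InitialObject.

(** For an initial carrier both the object component of a morphism and its
compatibility with the coactions come for free; the next lemma is the dual
situation for modules. *)
Lemma bijective_gcom_cfun (V : monoidal_category) (X Y : gcomodule V) :
  is_initial (rcom_ob X) -> bijective (@gcom_cfun V X Y).
Proof.
move=> X_init; have [k _] := X_init (rcom_ob Y).
exists (fun g => @GcomoduleHom V X Y k g (initial_eq _ _ X_init)) => //= l.
by apply: gcomodule_hom_eq => //; apply: initial_eq.
Qed.

Lemma bijective_gmod_mfun (V : monoidal_category) (M N : gmodule V) :
  is_terminal (rmod_ob N) -> bijective (@gmod_mfun V M N).
Proof.
move=> N_term; have [p _] := N_term (rmod_ob M).
exists (fun f => @GmoduleHom V M N p f (terminal_eq _ _ N_term)) => //= q.
by apply: gmodule_hom_eq => //; apply: terminal_eq.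
Qed.

(** The comodules tested against [Q] are those carried by the initial object:
on them the universal property of [Q] only sees comonoids and monoids. *)
Lemma underlying_comonoid_universal (V : bmc_category) (A B : monoid V)
    (M : rmodule A) (N : rmodule B) (Q : gcomodule V) :
  has_initial V -> is_universal_measuring_comodule M N Q ->
  is_universal_measuring_comonoid A B (underlying_comonoid Q).
Proof.
move=> [O O_init] [phi [phi_bij phi_nat]].
apply: (@represents_of_element (Comon V) (Mon V) (conv_monoid_functor B) _ _
          (gmod_mfun (phi Q (idm (c := Comod V) Q)))) => C.
have [X XE] := initial_rcomodule O_init C; rewrite -{O}XE in O_init.
have [lift cfunK liftK] := @bijective_gcom_cfun _ (Gcomodule X) Q O_init.
have lift_bij : bijective lift by exists (@gcom_cfun V (Gcomodule X) Q).
have mfun_bij := @bijective_gmod_mfun _ (Gmodule M)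
  (conv_gmodule (Gmodule N) (Gcomodule X)) (terminal_ihom O_init N).
(* By Yoneda for [phi], acting with a comonoid map [h : C ~> P] on the universal
   element of [P] is lifting [h] to [X ~> Q], applying [phi], and keeping the
   monoid part. *)
apply: (eq_bij (bij_comp mfun_bij (bij_comp (phi_bij (Gcomodule X)) lift_bij))).
move=> h /=; rewrite (representation_element phi_nat) /=.
by rewrite liftK.
Qed.

Theorem lemma5p4 (V : bmc_category) (hV : has_initial V)
    (A B : monoid V) (M : rmodule A) (N : rmodule B) :
  ((exists Q : gcomodule V, is_universal_measuring_comodule M N Q) ->
   exists P : comonoid V, is_universal_measuring_comonoid A B P)
  /\
  (forall Q : gcomodule V, is_universal_measuring_comodule M N Q ->
     is_universal_measuring_comonoid A B (underlying_comonoid Q)).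
Proof.
split=> [[Q Q_univ]|Q Q_univ]; last exact: underlying_comonoid_universal Q_univ.
exists (underlying_comonoid Q); exact: underlying_comonoid_universal Q_univ.
Qed.
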